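(* Let $E$ be an arbitrary directed graph. Then the map $\phi:\mathcal T_E\to\mathcal O_E$ given by $\phi((H,S))=U_{H,S}$ is a lattice isomorphism, whose inverse is the map $\rho:\mathcal O_E\to\mathcal T_E$ given by $\rho(U)=(H_U,S_U)$.
   Context: Graphs. A directed graph $E=(E^0,E^1,r,s)$ consists of disjoint sets $E^0$ (vertices), $E^1$ (edges) of arbitrary cardinality and maps $r,s:E^1\to E^0$ (range, source). A vertex $v$ is a sink if $s^{-1}(v)=\emptyset$, an infinite emitter if $s^{-1}(v)$ is infinite, and regular otherwise; $\mathrm{Inf}(E)$ is the set of infinite emitters. A finite path is either a vertex $v$ (length $0$, $s(v)=r(v)=v$) or a sequence $\mu=\mu_1\cdots\mu_n$ of edges with $r(\mu_i)=s(\mu_{i+1})$, with $s(\mu)=s(\mu_1)$, $r(\mu)=r(\mu_n)$, $|\mu|=n$. $\mathrm{Path}(E)$ is the set of finite paths and $E^\infty$ the set of infinite paths $x=x_1x_2\cdots$ ($r(x_i)=s(x_{i+1})$ for all $i$), with $s(x)=s(x_1)$. Convention: $r(x_0):=s(x)$. A set $H\subseteq E^0$ is hereditary if, whenever there is a path from $v\in H$ to $w$, then $w\in H$; a hereditary set $H$ is saturated if every regular vertex $v$ with $r(s^{-1}(v))\subseteq H$ lies in $H$. For $H$ hereditary, the set of breaking vertices is $B_H=\{v\in E^0\setminus H : v\in\mathrm{Inf}(E),\ 0<|s^{-1}(v)\cap r^{-1}(E^0\setminus H)|<\infty\}$. The lattice $\mathcal T_E$. $\mathcal T_E=\{(H,S):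 H\subseteq E^0 \text{ hereditary and saturated},\ S\subseteq B_H\}$, ordered by $(H_1,S_1)\le(H_2,S_2)$ iff $H_1\subseteq H_2$ and $S_1\subseteq S_2\cup H_2$; this order makes $\mathcal T_E$ a lattice. The groupoid. $X=E^\infty\cup\{\mu\in\mathrm{Path}(E): r(\mu)\text{ is a sink or an infinite emitter}\}$ and $G_E=\{(\alpha x,|\alpha|-|\beta|,\beta x):\alpha,\beta\in\mathrm{Path}(E),\ x\in X,\ r(\alpha)=r(\beta)=s(x)\}$, with $(x,k,y)(y,l,z)=(x,k+l,z)$ and $(x,k,y)^{-1}=(y,-k,x)$. The unit space $G_E^{(0)}=\{(x,0,x):x\in X\}$ is identified with $X$. For $\mu\in\mathrm{Path}(E)$ put $Z(\mu)=\{\mu x: x\in X,\ s(x)=r(\mu)\}$, and for finite $F\subseteq s^{-1}(r(\mu))$ put $Z(\mu\setminus F)=Z(\mu)\setminus\bigcup_{e\in F}Z(\mu e)$. The sets $Z(\mu\setminus F)$ form a basis of compact open sets for a Hausdorff topology on $G_E^{(0)}=X$. A subset $U\subseteq G_E^{(0)}$ is invariant if $x\in U$ and $(x,k,y)\in G_E$ imply $y\in U$. $\mathcal O_E$ is the set of open invariant subsets of $G_E^{(0)}$, a lattice under $(\subseteq,\cup,\cap)$. The maps. For $(H,S)\in\mathcal T_E$: $U_H=\{x\in G_E^{(0)}: r(x_n)\in H\text{ for some }n\ge 0\}$, $U_S=\{\alpha\in\mathrm{Path}(E): r(\alpha)\in S\}$, $U_{H,S}=U_H\sqcup U_S$. For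 $U\in\mathcal O_E$: $H_U=\{v\in E^0: Z(v)\subseteq U\}$ and $S_U=\{r(\alpha):\alpha\in U\cap\mathrm{Path}(E),\ r(\alpha)\text{ is an infinite emitter and } r(\alpha)\notin H_U\}$. *)

(* Defs.v *)
From HB Require Import structures.
From mathcomp Require Import all_boot all_order all_algebra.
From mathcomp Require Import mathcomp_extra boolp classical_sets functions.
From mathcomp Require Import cardinality topology.

Set Implicit Arguments.
Unset Strict Implicit.
Unset Printing Implicit Defensive.

Local Open Scope classical_set_scope.

(** * Directed graphs *)

Record digraph := Digraph {
  vertex : Type;
  edge : Type;
  ran : edge -> vertex;
  src : edge -> vertex }.

Section graph.
Variable E : digraph.
Implicit Types (v w : vertex E) (e f : edge E) (H S : set (vertex E)).

(* [outedges v] is s^{-1}(v) *)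
Definition outedges v : set (edge E) := @src E @^-1` [set v].

Definition sink v := outedges v = set0.
Definition inf_emitter v := infinite_set (outedges v).
Definition regular v := ~ sink v /\ ~ inf_emitter v.

(** ** Finite paths *)

Fixpoint composable v (s : seq (edge E)) : Prop :=
  if s is e :: s' then src e = v /\ composable (ran e) s' else True.

(* The vertex [v], as a path of length 0, is the path starting at [v] with no
   edges; for a nonempty list of edges, [composable] forces [fsrc] to be the
   source of the first edge. *)
Record finpath := FinPath {
  fsrc : vertex E;
  fedges : seq (edge E);
  finpathP : composable fsrc fedges }.

Definition fran (mu : finpath) := last (fsrc mu) (map (@ran E) (fedges mu)).
Definition flen (mu : finpath) := size (fedges mu).

Definition fvertex v : finpath := @FinPath v [::] I.
Definition fedge e : finpath := @FinPath (src e) [:: e] (conj erefl I).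

Lemma finpath_eq (mu nu : finpath) :
  fsrc mu = fsrc nu -> fedges mu = fedges nu -> mu = nu.
Proof.
case: mu nu => [v s p] [w t q] /= vw st; subst w t.
by congr FinPath; exact: Prop_irrelevance.
Qed.

Lemma composable_cat v s t : composable v (s ++ t) <->
  composable v s /\ composable (last v (map (@ran E) s)) t.
Proof.
by elim: s v => [|e s IH] v /=; [split=> [|[]]|rewrite IH; split=> [[? []]|[[]]]].
Qed.

Lemma fcat_subproof (mu nu : finpath) :
  fran mu = fsrc nu -> composable (fsrc mu) (fedges mu ++ fedges nu).
Proof.
move=> h; apply/composable_cat; split; first exact: finpathP.
by rewrite [last _ _]h; exact: finpathP.
Qed.

Definition fcat (mu nu : finpath) (h : fran mu = fsrc nu) : finpath :=
  FinPath (fcat_subproof h).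

Lemma fran_cat (mu nu : finpath) (h : fran mu = fsrc nu) :
  fran (fcat h) = fran nu.
Proof. by rewrite /fran /= map_cat last_cat [last (fsrc mu) _]h. Qed.

(** ** Infinite paths, indexed from 0: the first edge is [iedge x 0] *)

Record ipath := IPath {
  iedge : nat -> edge E;
  ipathP : forall i, ran (iedge i) = src (iedge i.+1) }.

Definition isrc (x : ipath) := src (iedge x 0).

Fixpoint prepend (T : Type) (s : seq T) (x : nat -> T) : nat -> T :=
  if s is e :: s' then fun n => if n is m.+1 then prepend s' x m else e else x.

Lemma icat_subproof (mu : finpath) (x : ipath) : fran mu = isrc x ->
  forall i, ran (prepend (fedges mu) (iedge x) i) =
            src (prepend (fedges mu) (iedge x) i.+1).
Proof.
case: mu => v s; rewrite /fran /=; elim: s v => [|e s IH] v /=.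
  by move=> _ _; exact: ipathP.
move=> [_ p] h [|i]; last exact: (IH _ p h i).
by case: s p h {IH} => [|f s] /=; [move=> _ -> | case=> -> ].
Qed.

Definition icat (mu : finpath) (x : ipath) (h : fran mu = isrc x) : ipath :=
  IPath (icat_subproof h).

(** ** The boundary path space X, which is also the unit space of [gpd] *)

Inductive bpath :=
  | BFin (mu : finpath) of sink (fran mu) \/ inf_emitter (fran mu)
  | BInf of ipath.

Definition bsrc (x : bpath) :=
  match x with BFin mu _ => fsrc mu | BInf y => isrc y end.

(* [bran x n] is r(x_n), with r(x_0) := s(x); it is [None] when [x] is finite
   of length less than [n] *)
Definition bran (x : bpath) (n : nat) : option (vertex E) :=
  match x with
  | BFin mu _ => onth (fsrc mu :: map (@ran E) (fedges mu)) n
  | BInf y => Some (if n is m.+1 then ran (iedge y m) else isrc y)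
  end.

Lemma bcat_subproof (mu nu : finpath) (h : fran mu = fsrc nu) :
  sink (fran nu) \/ inf_emitter (fran nu) ->
  sink (fran (fcat h)) \/ inf_emitter (fran (fcat h)).
Proof. by rewrite fran_cat. Qed.

Definition bcat (mu : finpath) (x : bpath) : fran mu = bsrc x -> bpath :=
  match x with
  | BFin nu p => fun h => BFin (@bcat_subproof mu nu h p)
  | BInf y => fun h => BInf (@icat mu y h)
  end.

Definition cyl (mu : finpath) : set bpath :=
  [set y | exists (x : bpath) (h : fran mu = bsrc x), y = bcat h].

(* Z(mu \ F); only used for F finite, F included in s^{-1}(r(mu)) *)
Definition cylD (mu : finpath) (F : set (edge E)) : set bpath :=
  cyl mu `\` [set x | exists (e : edge E) (h : fran mu = fsrc (fedge e)),
                        F e /\ cyl (fcat h) x].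

Definition basic_cyl : set (set bpath) :=
  [set A | exists (mu : finpath) (F : set (edge E)),
     [/\ finite_set F, F `<=` outedges (fran mu) & A = cylD mu F]].

(** ** The basic cylinders form a base *)

Definition trace (x : bpath) (n : nat) : option (edge E) :=
  match x with BFin mu _ => onth (fedges mu) n | BInf y => Some (iedge y n) end.

Lemma bfin_eq (mu nu : finpath) p q : mu = nu -> @BFin mu p = @BFin nu q.
Proof. by move=> h; subst nu; congr BFin; exact: Prop_irrelevance. Qed.

Lemma binf_eq (x y : ipath) : iedge x =1 iedge y -> BInf x = BInf y.
Proof.
case: x y => [x p] [y q] /= /funext h; subst y.
by congr (BInf (IPath _)); exact: Prop_irrelevance.
Qed.

Lemma bsrc_cat (mu : finpath) (x : bpath) (h : fran mu = bsrc x) :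
  bsrc (bcat h) = fsrc mu.
Proof.
case: x h => [nu p|y] //= h; rewrite /isrc /=.
by case: mu h => v [|e s] p h //=; exact: p.1.
Qed.

Lemma trace_cat (mu : finpath) (x : bpath) (h : fran mu = bsrc x) n :
  (n < flen mu)%N -> trace (bcat h) n = onth (fedges mu) n.
Proof.
case: x h => [nu p|y] /= h; rewrite /flen; elim: (fedges mu) n => //= e s IH.
  by case=> //= n /IH.
by case=> //= n /IH.
Qed.

Lemma cylP (mu : finpath) x : cyl mu x -> bsrc x = fsrc mu /\
  forall n, (n < flen mu)%N -> trace x n = onth (fedges mu) n.
Proof.
by move=> [y [h ->]]; split; [exact: bsrc_cat | exact: trace_cat].
Qed.

Lemma cyl_fcat (mu nu : finpath) (h : fran mu = fsrc nu) :
  cyl (fcat h) `<=` cyl mu.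
Proof.
move=> _ [x [k ->]].
have k' : fran nu = bsrc x by rewrite -(fran_cat h).
have h' : fran mu = bsrc (bcat k') by rewrite bsrc_cat.
exists (bcat k'), h'; case: x k k' h' => [ka p|y] /= k k' h'.
  by apply: bfin_eq; apply: finpath_eq => //=; rewrite catA.
by apply: binf_eq => i /=; elim: (fedges mu) i => //= e s IH [|i].
Qed.

Lemma cyl_prefix (mu nu : finpath) x : cyl mu x -> cyl nu x ->
  (flen mu <= flen nu)%N ->
  exists (ka : finpath) (h : fran mu = fsrc ka), nu = fcat h.
Proof.
move=> /cylP[s1 t1] /cylP[s2 t2] le.
have E1 : take (flen mu) (fedges nu) = fedges mu.
  have : forall n, (n < flen mu)%N -> onth (fedges mu) n = onth (fedges nu) n.
    by move=> n nmu; rewrite -t1// t2//; exact: leq_trans le.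
  move: le; rewrite /flen; elim: (fedges mu) (fedges nu) => [|e s IH] [|f t] //=.
  move=> st h; have [->] := h 0%N erefl; congr cons; apply: IH => // n ns.
  exact: (h n.+1 ns).
have E2 : fedges nu = fedges mu ++ drop (flen mu) (fedges nu).
  by rewrite -{1}E1 cat_take_drop.
have : composable (fsrc nu) (fedges mu ++ drop (flen mu) (fedges nu)).
  by rewrite -E2; exact: finpathP.
rewrite -s2 s1 => /composable_cat[_ p].
by exists (FinPath p), erefl; apply: finpath_eq => //=; rewrite -s2.
Qed.

Lemma cyl_fedge_inj (mu : finpath) e f (h : fran mu = fsrc (fedge e))
    (k : fran mu = fsrc (fedge f)) x :
  cyl (fcat h) x -> cyl (fcat k) x -> e = f.
Proof.
move=> /cylP[_ /(_ (flen mu))] + /cylP[_ /(_ (flen mu))].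
rewrite /flen /= !size_cat /= addn1 ltnSn => /(_ isT) -> /(_ isT).
by rewrite !onthE !map_cat !nth_cat !size_map ltnn subnn /= => -[].
Qed.

Lemma cylD_join (mu nu : finpath) F G x : (flen mu <= flen nu)%N ->
  finite_set F -> F `<=` outedges (fran mu) ->
  finite_set G -> G `<=` outedges (fran nu) ->
  cylD mu F x -> cylD nu G x ->
  exists C, [/\ basic_cyl C, C x & C `<=` cylD mu F `&` cylD nu G].
Proof.
move=> le finF sF finG sG Fx Gx.
have [ka [h nuE]] := cyl_prefix Fx.1 Gx.1 le.
case kaE: (fedges ka) => [|e s].
  have nm : nu = mu by rewrite nuE; apply: finpath_eq => //=; rewrite kaE cats0.
  move: Gx sG; rewrite nm => -[_ Gx] sG.
  exists (cylD mu (F `|` G)); split.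
  - exists mu, (F `|` G); split=> //; first by rewrite finite_setU.
    by move=> e [/sF|/sG].
  - split; first exact: Fx.1.
    move=> [e [k [[Fe|Ge] Z]]]; first by apply: Fx.2; exists e, k.
    by apply: Gx; exists e, k.
  - move=> y [Zy ny]; split; split=> // -[e [k [Fe Z]]]; apply: ny; exists e, k.
      by split=> //; left.
    by split=> //; right.
have [se p] : composable (fsrc ka) (e :: s) by rewrite -kaE; exact: finpathP.
have k : fran mu = fsrc (fedge e) by rewrite /= se.
have k' : fran (fcat k) = fsrc (FinPath p) by rewrite fran_cat.
have nuE' : nu = fcat k'.
  by rewrite nuE; apply: finpath_eq => //=; rewrite kaE -catA.
have subZ : cyl nu `<=` cyl (fcat k) by rewrite nuE'; exact: cyl_fcat.
exists (cylD nu G); split=> //; first by exists nu, G.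
move=> y Gy; split=> //; split; first exact: cyl_fcat (subZ _ Gy.1).
move=> [f [l [Ff Z]]]; apply: Fx.2; exists e, k; split; last exact: subZ Gx.1.
by rewrite (cyl_fedge_inj (subZ _ Gy.1) Z).
Qed.

Lemma basic_cyl_cover : \bigcup_(A in basic_cyl) A = [set: bpath].
Proof.
apply/seteqP; split=> // x _.
exists (cylD (fvertex (bsrc x)) set0); last first.
  split; last by move=> [e [h []]].
  exists x, erefl; case: x => [mu p|y] /=; first exact/bfin_eq/finpath_eq.
  exact: binf_eq.
by exists (fvertex (bsrc x)), set0; split.
Qed.

Lemma basic_cyl_join (A B : set bpath) x : basic_cyl A -> basic_cyl B ->
  A x -> B x -> exists C, [/\ basic_cyl C, C x & C `<=` A `&` B].
Proof.
move=> [mu [F [finF sF ->]]] [nu [G [finG sG ->]]] Ax Bx.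
have [le|/ltnW le] := leqP (flen mu) (flen nu); first exact: cylD_join.
by rewrite setIC; exact: cylD_join.
Qed.

End graph.

HB.instance Definition _ (E : digraph) := gen_eqMixin (bpath E).
HB.instance Definition _ (E : digraph) := gen_choiceMixin (bpath E).
HB.instance Definition _ (E : digraph) := isBaseTopological.Build (bpath E)
  (@basic_cyl_cover E) (@basic_cyl_join E).

Section groupoid.
Variable E : digraph.
Implicit Types (H S : set (vertex E)) (U : set (bpath E)).

Definition gpd : set (bpath E * int * bpath E) :=
  [set g | exists (al be : finpath E) (x : bpath E)
             (h : fran al = bsrc x) (k : fran be = bsrc x),
     g = (bcat h, (flen al)%:Z - (flen be)%:Z, bcat k)%R].

Definition invariant U :=
  forall x n y, U x -> gpd (x, n, y) -> U y.

Definition hereditary H := forall mu : finpath E, H (fsrc mu) -> H (fran mu).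

Definition saturated H := forall v : vertex E,
  regular v -> @ran E @` outedges v `<=` H -> H v.

(* B_H *)
Definition breaking H : set (vertex E) :=
  [set v | [/\ ~ H v, inf_emitter v,
      outedges v `&` @ran E @^-1` (~` H) !=set0 &
      finite_set (outedges v `&` @ran E @^-1` (~` H))]].

Definition U_H H : set (bpath E) :=
  [set x | exists n v, bran x n = Some v /\ H v].

Definition U_S S : set (bpath E) :=
  [set x | exists al p, x = @BFin E al p /\ S (fran al)].

Definition U_HS H S := U_H H `|` U_S S.

(* The union defining U_{H,S} is disjoint. *)
Lemma U_HS_disjoint H S : hereditary H -> S `<=` breaking H ->
  U_H H `&` U_S S = set0.
Proof.
move=> her SB; apply/seteqP; split=> // x [[n [v [xn Hv]]] [al [p [xE Sal]]]].
rewrite xE /= in xn; have [nH _ _ _] := SB _ Sal; apply: nH.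
have [t [ct lt]] : exists t, composable v t /\
    last v (map (@ran E) t) = fran al.
  move: xn; rewrite /fran; have := finpathP al.
  elim: (fedges al) (fsrc al) n => [|e s IH] w [|n] /=.
  - by move=> _ [<-]; exists [::].
  - by rewrite onth0n.
  - by move=> c [<-]; exists (e :: s).
  - by move=> [_ c]; exact: IH.
by rewrite -lt; exact: (her (FinPath ct)).
Qed.

Definition H_U U : set (vertex E) := [set v | cyl (fvertex v) `<=` U].

Definition S_U U : set (vertex E) :=
  [set v | exists al p, [/\ U (@BFin E al p), fran al = v,
                            inf_emitter v & ~ H_U U v]].

End groupoid.

(** * The lattice of pairs (H, S) *)

Record TE (E : digraph) := MkTE {
  teH : set (vertex E);
  teS : set (vertex E);
  te_hereditary : hereditary teH;
  te_saturated : saturated teH;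
  te_breaking : teS `<=` breaking teH }.

HB.instance Definition _ (E : digraph) := gen_eqMixin (TE E).
HB.instance Definition _ (E : digraph) := gen_choiceMixin (TE E).

Section TE_lattice.
Variable E : digraph.
Implicit Types (a b c : TE E) (A : set (TE E)).

Lemma TE_eq a b : teH a = teH b -> teS a = teS b -> a = b.
Proof.
case: a b => [H S p q r] [H' S' p' q' r'] /= HH SS; subst H' S'.
by congr MkTE; exact: Prop_irrelevance.
Qed.

Definition TE_le a b : bool :=
  `[< teH a `<=` teH b /\ teS a `<=` teS b `|` teH b >].

Lemma TE_le_refl : reflexive TE_le.
Proof. by move=> a; apply/asboolP; split=> // v; left. Qed.

Lemma TE_le_anti : antisymmetric TE_le.
Proof.
move=> a b /andP[/asboolP[ab sab] /asboolP[ba sba]].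
have HH : teH a = teH b by apply/seteqP.
apply: TE_eq => //; apply/seteqP; split=> v Sv.
  have [//|] := sab _ Sv; rewrite -HH => Hv.
  by have [] := te_breaking Sv.
have [//|] := sba _ Sv; rewrite HH => Hv.
by have [] := te_breaking Sv.
Qed.

Lemma TE_le_trans : transitive TE_le.
Proof.
move=> b a c /asboolP[ab sab] /asboolP[bc sbc]; apply/asboolP; split.
  exact: subset_trans bc.
by move=> v /sab[/sbc//|/bc]; right.
Qed.

(* Arbitrary meets exist; they give binary joins as meets of upper bounds. *)
Let infH A := [set v | forall a, A a -> teH a v].
Let infS A :=
  [set v | breaking (infH A) v /\ forall a, A a -> (teS a `|` teH a) v].

Lemma TE_inf_hereditary A : hereditary (infH A).
Proof. by move=> mu h a Aa; apply: te_hereditary; exact: h. Qed.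

Lemma TE_inf_saturated A : saturated (infH A).
Proof.
move=> v rv h a Aa; apply: te_saturated => // w hw.
exact: (h w hw).
Qed.

Lemma TE_inf_breaking A : infS A `<=` breaking (infH A).
Proof. by move=> v []. Qed.

Definition TE_inf A : TE E :=
  MkTE (@TE_inf_hereditary A) (@TE_inf_saturated A) (@TE_inf_breaking A).

Lemma TE_inf_lb A a : A a -> TE_le (TE_inf A) a.
Proof. by move=> Aa; apply/asboolP; split=> v /=; [apply | case=> _; apply]. Qed.

Lemma TE_inf_glb A c : (forall a, A a -> TE_le c a) -> TE_le c (TE_inf A).
Proof.
move=> h.
have hH : teH c `<=` infH A by move=> v cv a /h/asboolP[+ _]; apply.
apply/asboolP; split=> // v Sv.
have [Hv|nHv] := pselect (infH A v); [by right | left].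
have hS a : A a -> (teS a `|` teH a) v by move=> /h/asboolP[_]; apply.
split=> //; have [_ iv _ fv] := te_breaking Sv; split=> //.
- have [a Aa nav] : exists2 a, A a & ~ teH a v.
    apply: contrapT => na; apply: nHv => a Aa; apply: contrapT => nav.
    by apply: na; exists a.
  have [/te_breaking[_ _ [e [oe re]] _]|//] := hS a Aa.
  by exists e; split=> // /(_ a Aa).
- by apply: sub_finite_set fv => e [oe re]; split=> // /hH.
Qed.

Definition TE_meet a b := TE_inf [set a; b].
Definition TE_join a b := TE_inf [set c | TE_le a c /\ TE_le b c].

Lemma TE_meetP a b c : TE_le a (TE_meet b c) = TE_le a b && TE_le a c.
Proof.
apply/idP/andP => [h|[ab ac]]; last by apply: TE_inf_glb => _ [|] ->.
by split; apply: TE_le_trans h _; apply: TE_inf_lb; [left|right].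
Qed.

Lemma TE_joinP a b c : TE_le (TE_join a b) c = TE_le a c && TE_le b c.
Proof.
apply/idP/andP => [h|[ac bc]]; last exact: TE_inf_lb.
by split; apply: TE_le_trans h; apply: TE_inf_glb => d [].
Qed.

End TE_lattice.

HB.instance Definition _ (E : digraph) :=
  Order.Le_isPOrder.Build Order.default_display (TE E)
    (@TE_le_refl E) (@TE_le_anti E) (@TE_le_trans E).
HB.instance Definition _ (E : digraph) :=
  Order.POrder_MeetJoin_isLattice.Build Order.default_display (TE E)
    (@TE_meetP E) (@TE_joinP E).

(** * The lattice of open invariant subsets of X *)

Record OE (E : digraph) := MkOE {
  oeU :> set (bpath E);
  oe_open : open oeU;
  oe_invariant : invariant oeU }.

HB.instance Definition _ (E : digraph) := gen_eqMixin (OE E).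
HB.instance Definition _ (E : digraph) := gen_choiceMixin (OE E).

Section OE_lattice.
Variable E : digraph.
Implicit Types U V W : OE E.

Lemma OE_eq U V : oeU U = oeU V -> U = V.
Proof.
case: U V => [U p q] [V p' q'] /= UV; subst V.
by congr MkOE; exact: Prop_irrelevance.
Qed.

Definition OE_le U V : bool := `[< oeU U `<=` oeU V >].

Lemma OE_le_refl : reflexive OE_le.
Proof. by move=> U; apply/asboolP. Qed.

Lemma OE_le_anti : antisymmetric OE_le.
Proof. by move=> U V /andP[/asboolP ? /asboolP ?]; apply/OE_eq/seteqP. Qed.

Lemma OE_le_trans : transitive OE_le.
Proof.
by move=> V U W /asboolP UV /asboolP VW; apply/asboolP/(subset_trans UV).
Qed.

Lemma OE_meet_invariant U V : invariant (oeU U `&` oeU V).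
Proof. by move=> x n y [Ux Vx] g; split; exact: oe_invariant g. Qed.

Definition OE_meet U V : OE E :=
  MkOE (openI (@oe_open _ U) (@oe_open _ V)) (@OE_meet_invariant U V).

Lemma OE_join_invariant U V : invariant (oeU U `|` oeU V).
Proof. by move=> x n y [Ux|Vx] g; [left|right]; exact: oe_invariant g. Qed.

Definition OE_join U V : OE E :=
  MkOE (openU (@oe_open _ U) (@oe_open _ V)) (@OE_join_invariant U V).

Lemma OE_meetP U V W : OE_le U (OE_meet V W) = OE_le U V && OE_le U W.
Proof.
rewrite /OE_le /= -asbool_and; congr asbool; exact: subsetI.
Qed.

Lemma OE_joinP U V W : OE_le (OE_join U V) W = OE_le U W && OE_le V W.
Proof.
rewrite /OE_le /= -asbool_and; congr asbool; exact: subUset.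
Qed.

End OE_lattice.

HB.instance Definition _ (E : digraph) :=
  Order.Le_isPOrder.Build Order.default_display (OE E)
    (@OE_le_refl E) (@OE_le_anti E) (@OE_le_trans E).
HB.instance Definition _ (E : digraph) :=
  Order.POrder_MeetJoin_isLattice.Build Order.default_display (OE E)
    (@OE_meetP E) (@OE_joinP E).

(* Main.v *)
(** The boundary path space is explored one edge at a time: every point is a
    vertex or [e x] with [r(e) = s(x)], and invariance of [U] means that [mu x]
    is in [U] iff [x] is.  If [U] is open and [mu x] is in [Z(mu \ F)], itself
    inside [U], then [r(e)] is in [H_U] for all edges [e] from [r(mu)] outside
    the finite set [F]; this gives both that [S_U] consists of breaking vertices
    of [H_U] and that [U] is the union of [U_{H_U}] and [U_{S_U}].  Conversely,
    [H] is recovered from [U_{H,S}] by building, from any vertex outside [H], a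
    boundary path that avoids [U_{H,S}].  Both maps are monotone, and an
    order isomorphism preserves meets and joins. *)

From HB Require Import structures.
Require Import Defs.
From mathcomp Require Import all_boot all_order boolp classical_sets.
From mathcomp Require Import all_algebra cardinality topology.

Set Implicit Arguments.
Unset Strict Implicit.
Unset Printing Implicit Defensive.

(* Again, since [eqtype] also has an [invariant]. *)
Import Defs.
Import Order.TTheory.
Local Open Scope classical_set_scope.

(** * Splitting boundary paths; invariance and openness in terms of splittings *)

Section boundary_paths.
Variable E : digraph.
Implicit Types (v w : vertex E) (e : edge E) (mu nu : finpath E) (x y : bpath E).

Lemma bcat_fvertex v x (h : fran (fvertex v) = bsrc x) : bcat h = x.
Proof.
case: x h => [mu p|y] h; last exact: binf_eq.
exact/bfin_eq/finpath_eq.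
Qed.

Lemma bcatA mu nu (h : fran mu = fsrc nu) x (k : fran nu = bsrc x)
    (hk : fran (fcat h) = bsrc x) (h' : fran mu = bsrc (bcat k)) :
  bcat hk = bcat h'.
Proof.
case: x k hk h' => [ka p|y] /= k hk h'.
  by apply: bfin_eq; apply: finpath_eq => //=; rewrite catA.
by apply: binf_eq => i /=; elim: (fedges mu) i => //= e s IH [|i].
Qed.

Lemma bcat_fin mu nu p (h : fran mu = bsrc (@BFin E nu p)) :
  exists k : fran mu = fsrc nu, exists q, bcat h = @BFin E (fcat k) q.
Proof. by exists h; eexists; reflexivity. Qed.

Lemma cyl_fvertex v x : cyl (fvertex v) x <-> bsrc x = v.
Proof.
split=> [/cylP[]//|xv]; have h : fran (fvertex v) = bsrc x by rewrite xv.
by exists x, h; rewrite bcat_fvertex.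
Qed.

Lemma prepend_size (T : Type) (s : seq T) (f : nat -> T) n :
  prepend s f (size s + n) = f n.
Proof. by elim: s. Qed.

Lemma bran_inf (y : ipath E) n : bran (BInf y) n = Some (src (iedge y n)).
Proof. by case: n => [//|n]; rewrite /= ipathP. Qed.

Lemma bran0 x : bran x 0 = Some (bsrc x).
Proof. by case: x. Qed.

Lemma bran_bcat mu x (h : fran mu = bsrc x) n :
  bran (bcat h) (flen mu + n) = bran x n.
Proof.
case: x h => [nu p|y] h; last by rewrite !bran_inf /= prepend_size.
move: h; rewrite /fran /flen /=; elim: (fedges mu) (fsrc mu) => [|e s IH] v /=.
  by move=> ->.
exact: IH.
Qed.

Lemma trace_bcat mu x (h : fran mu = bsrc x) n :
  trace (bcat h) (flen mu + n) = trace x n.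
Proof.
case: x h => [nu p|y] h; last by rewrite /= prepend_size.
by rewrite /= /flen; elim: (fedges mu).
Qed.

(** Replaces the split into finite and infinite paths by one on the first edge, the form in which
    invariance applies. *)
Lemma bpath_case x :
  (exists e y (h : fran (fedge e) = bsrc y), x = bcat h) \/
  (exists v p, x = @BFin E (fvertex v) p).
Proof.
case: x => [[v [|e s] /= c] p|y].
- by right; exists v, p; exact/bfin_eq/finpath_eq.
- left; exists e, (@BFin E (FinPath c.2) p), erefl.
  by apply/bfin_eq/finpath_eq => //=; rewrite -c.1.
- left; pose z := IPath (fun i => ipathP y i.+1).
  have h : fran (fedge (iedge y 0)) = bsrc (BInf z) by exact: ipathP.
  by exists (iedge y 0), (BInf z), h; apply: binf_eq => -[].
Qed.

(** Turns a visit to [v] into a factorisation, by peeling off first edges. *)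
Lemma bran_split x n v : bran x n = Some v ->
  exists mu y (h : fran mu = bsrc y),
    [/\ x = bcat h, bsrc y = v & flen mu = n].
Proof.
elim: n x => [|n IH] x.
  rewrite bran0 => -[xv]; exists (fvertex (bsrc x)), x, erefl.
  by rewrite bcat_fvertex.
have [[e [y [h ->]]]|[w [p ->]]] := bpath_case x; last by rewrite /= onth0n.
rewrite -[n.+1]/(flen (fedge e) + n) bran_bcat => /IH[mu [z [k [yE zv mun]]]].
subst y; have k0 : fran (fedge e) = fsrc mu by rewrite h bsrc_cat.
have hk : fran (fcat k0) = bsrc z by rewrite fran_cat.
by exists (fcat k0), z, hk; rewrite (bcatA hk h) -mun.
Qed.

Lemma hereditary_bran (H : set (vertex E)) x m n v w : hereditary H ->
  bran x m = Some v -> bran x n = Some w -> (m <= n)%N -> H v -> H w.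
Proof.
move=> her /bran_split[mu [y [h [-> yv <-]]]] + mn Hv.
rewrite -(subnKC mn) bran_bcat => /bran_split[nu [z [k [yE zw _]]]].
by rewrite -zw -k; apply: her; rewrite -(bsrc_cat k) -yE yv.
Qed.

Lemma bfin_bcat mu p : exists h : fran mu = bsrc (@BFin E (fvertex (fran mu)) p),
  @BFin E mu p = bcat h.
Proof. by exists erefl; apply/bfin_eq/finpath_eq => //=; rewrite cats0. Qed.

(** Only the edge right after [mu] matters; a trivial [x] has no such edge and avoids every [F]. *)
Lemma cylD_bcat mu (F : set (edge E)) x (h : fran mu = bsrc x) :
  cylD mu F (bcat h) <-> forall e, F e -> trace x 0 <> Some e.
Proof.
split=> [[_ nZ] e Fe xe|nF].
  have [[f [y [k xE]]]|[v [p xE]]] := bpath_case x; last by rewrite xE in xe.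
  subst x; have fe : f = e.
    by move: xe; rewrite (@trace_cat _ (fedge f)) // => -[].
  subst f; apply: nZ; have k0 : fran mu = fsrc (fedge e) by rewrite h bsrc_cat.
  exists e, k0; split=> //.
  have hk : fran (fcat k0) = bsrc y by rewrite fran_cat.
  by exists y, hk; rewrite (bcatA hk h).
split; first by exists x, h.
(* Position [flen mu] carries [e] on Z(mu e), and in [bcat h] it is position 0 of [x]. *)
move=> [e [k [Fe /cylP[_ /(_ (flen mu))]]]]; rewrite -{2}[flen mu]addn0 trace_bcat.
rewrite /flen /= size_cat addn1 ltnSn => /(_ isT) xe; apply: (nF e Fe).
by rewrite xe; elim: (fedges mu).
Qed.

(** Paths related by the groupoid share a tail, so membership passes through that tail; conversely,
    taking one of the two prefixes to be a vertex relates mu x to x. *)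
Lemma invariantP (U : set (bpath E)) : invariant U <->
  forall mu x (h : fran mu = bsrc x), U (bcat h) <-> U x.
Proof.
split=> [inv mu x h|inv x n y Ux].
  have k : fran (fvertex (bsrc x)) = bsrc x by [].
  split=> Ux.
    apply: (inv _ ((flen mu)%:Z - (flen (fvertex (bsrc x)))%:Z)%R _ Ux).
    by exists mu, (fvertex (bsrc x)), x, h, k; rewrite bcat_fvertex.
  apply: (inv _ ((flen (fvertex (bsrc x)))%:Z - (flen mu)%:Z)%R _ Ux).
  by exists (fvertex (bsrc x)), mu, x, k, h; rewrite bcat_fvertex.
by move=> [al [be [z [h [k [xE _ ->]]]]]]; rewrite inv -(inv al z h) -xE.
Qed.

Lemma invariantE (U : set (bpath E)) mu x (h : fran mu = bsrc x) :
  invariant U -> U (bcat h) = U x.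
Proof. by move=> /invariantP inv; exact/propext. Qed.

Lemma open_cylP (U : set (bpath E)) : open U <->
  forall x, U x -> exists mu F, [/\ finite_set F, F `<=` outedges (fran mu),
    cylD mu F x & cylD mu F `<=` U].
Proof.
split=> [[D sD <-] x [A DA Ax]|h].
  have [mu [F [finF sF AE]]] := sD _ DA.
  by exists mu, F; split=> //; rewrite -AE // => y Ay; exists A.
exists [set A | basic_cyl A /\ A `<=` U]; first by move=> A [].
apply/seteqP; split=> [x [A [_ AU]] /AU//|x /h[mu [F [? ? ? ?]]]].
by exists (cylD mu F) => //; split=> //; exists mu, F.
Qed.

End boundary_paths.

(** * From an open invariant set to a pair *)

Section open_invariant.
Variables (E : digraph) (U : set (bpath E)).
Hypothesis invU : invariant U.
Implicit Types (v w : vertex E) (e : edge E) (mu nu : finpath E) (x y : bpath E).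

Lemma H_UP v : H_U U v <-> forall x, bsrc x = v -> U x.
Proof. by split=> h x /cyl_fvertex; exact: h. Qed.

Lemma H_U_hereditary : hereditary (H_U U).
Proof.
move=> mu /H_UP h; apply/H_UP => x xmu.
by rewrite -(invariantE (esym xmu) invU); apply/h/bsrc_cat.
Qed.

(** A boundary path from [v] is trivial or of the form e y, and invariance reduces e y to y, which
    starts at r(e). *)
Lemma H_U_vertex v : (forall e, src e = v -> H_U U (ran e)) ->
  (forall p, U (@BFin E (fvertex v) p)) -> H_U U v.
Proof.
move=> he hv; apply/H_UP => x.
have [[e [y [h ->]]]|[w [p ->]]] := bpath_case x; last first.
  by move=> /= wv; subst w; exact: hv.
rewrite bsrc_cat => ev; rewrite invariantE //.
by move/he/H_UP: ev; apply; rewrite -h.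
Qed.

Lemma H_U_saturated : saturated (H_U U).
Proof.
(* No trivial boundary path sits at a regular vertex. *)
move=> v [ns ni] h; apply: H_U_vertex => [e ev|[]//].
by apply: h; exists e.
Qed.

Lemma invariant_bfin mu p :
  U (@BFin E mu p) <-> U (@BFin E (fvertex (fran mu)) p).
Proof. by have [h ->] := bfin_bcat p; rewrite invariantE. Qed.

Lemma S_UP v : S_U U v <->
  [/\ inf_emitter v, ~ H_U U v & exists p, U (@BFin E (fvertex v) p)].
Proof.
split=> [[al [p [+ <- iv nv]]]|[iv nv [p Uv]]].
  by rewrite invariant_bfin; split=> //; exists p.
by exists (fvertex v), p.
Qed.

Hypothesis openU : open U.

(* A basic cylinder Z(mu \ F) inside U contains Z(mu e) for every edge e outside
   F starting at r(mu), so that Z(r(e)) is in U by invariance. *)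
Lemma open_invariant_edges x : U x ->
  exists mu y (h : fran mu = bsrc y) F, [/\ x = bcat h, finite_set F,
    forall e, F e -> trace y 0 <> Some e &
    forall e, src e = fran mu -> ~ F e -> H_U U (ran e)].
Proof.
move=> /((open_cylP U).1 openU)[mu [F [finF sF Fx FU]]].
have [y [h xE]] := Fx.1; subst x; exists mu, y, h, F; split=> //.
  by move/cylD_bcat: Fx.
move=> e emu nFe; apply/H_UP => z ze.
have k : fran (fedge e) = bsrc z by rewrite ze.
have l : fran mu = bsrc (bcat k) by rewrite bsrc_cat -emu.
rewrite -(invariantE k invU) -(invariantE l invU).
apply/FU/cylD_bcat => f Ff; rewrite (@trace_cat _ (fedge e)) // => -[ef].
by apply: nFe; rewrite ef.
Qed.

Lemma S_U_breaking : S_U U `<=` breaking (H_U U).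
Proof.
move=> v /S_UP[iv nv [p Uv]]; split=> //.
  (* If all edges from [v] ended in [H_U U], then [v] would be in it too. *)
  apply: contrapT => h; apply: nv; apply: H_U_vertex => [e ev|q].
    by apply: contrapT => ne; apply: h; exists e.
  by rewrite (bfin_eq q p).
have [mu [y [h [F [xE finF _ hF]]]]] := open_invariant_edges Uv.
(* The trivial path at [v] has only the trivial prefix. *)
have muv : fran mu = v.
  have vs : fsrc mu = v by rewrite -(bsrc_cat h) -xE.
  case: y h xE => [nu q|y] //= h [_]; rewrite /fran vs.
  by case: (fedges mu).
apply: sub_finite_set finF => e [ev ne]; apply: contrapT => nFe.
by apply: ne; apply: hF => //; rewrite muv.
Qed.

Lemma U_HS_H_U_S_U : U_HS (H_U U) (S_U U) = U.
Proof.
apply/seteqP; split=> x.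
  move=> [[n [v [/bran_split[mu [y [h [-> yv _]]]] Hv]]]|[al [p [-> ]]]].
    by rewrite invariantE //; move/H_UP: Hv; exact.
  by move=> /S_UP[_ _ [q Uq]]; apply/invariant_bfin; rewrite (Prop_irrelevance p q).
move=> Ux; have [mu [y [h [F [xE _ nF hF]]]]] := open_invariant_edges Ux.
(* A first edge of [y] is not in [F], so it leads into [H_U U]. *)
have [[e [z [k yE]]]|[v [p yE]]] := bpath_case y; subst y.
  left; exists (flen mu + (flen (fedge e) + 0))%N, (ran e); split.
    by rewrite xE !bran_bcat bran0 -k.
  apply: hF => [|/nF]; first by rewrite h bsrc_cat.
  by apply; exact: trace_cat.
have [Hv|nHv] := pselect (H_U U v).
  by left; exists (flen mu + 0)%N, v; rewrite xE bran_bcat.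
move: Ux; rewrite xE invariantE // => Uv.
(* A sink would be in [H_U U] by [H_U_vertex], having no edges to check. *)
have [sv|iv] := p.
  exfalso; apply: nHv; apply: H_U_vertex => [e ev|q].
    by have : outedges v e by []; rewrite sv.
  by rewrite (bfin_eq q p).
right; have [k [q ->]] := bcat_fin h.
exists (fcat k), q; split=> //.
by rewrite fran_cat; apply/S_UP; split=> //; exists p.
Qed.

End open_invariant.

Lemma H_U_mono (E : digraph) (U V : set (bpath E)) :
  U `<=` V -> H_U U `<=` H_U V.
Proof. by move=> UV v Uv x /Uv/UV. Qed.

(** Enlarging [U] may move a vertex of [S_U U] into [H_U V], whence the union in the order on
    pairs. *)
Lemma S_U_mono (E : digraph) (U V : set (bpath E)) :
  U `<=` V -> S_U U `<=` S_U V `|` H_U V.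
Proof.
move=> UV v [al [p [/UV Val alv iv nv]]].
by have [|nVv] := pselect (H_U V v); [right|left; exists al, p].
Qed.

(** * From a pair to an open invariant set, and back *)

Section hereditary_saturated.
Variables (E : digraph) (H S : set (vertex E)).
Hypotheses (herH : hereditary H) (satH : saturated H) (SB : S `<=` breaking H).
Implicit Types (v w : vertex E) (e : edge E) (mu nu : finpath E) (x y : bpath E).

Lemma U_H_bcat mu x (h : fran mu = bsrc x) : U_H H (bcat h) <-> U_H H x.
Proof.
split=> [[n [v [xv Hv]]]|[n [v [xv Hv]]]]; last first.
  by exists (flen mu + n)%N, v; rewrite bran_bcat.
have [mun|/ltnW nmu] := leqP (flen mu) n.
  by exists (n - flen mu)%N, v; rewrite -(bran_bcat h) subnKC.
(* If [H] is met within [mu], heredity carries it on to the source of [x]. *)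
exists 0%N, (bsrc x); rewrite bran0; split=> //.
apply: (hereditary_bran herH xv _ nmu Hv).
by rewrite -[flen mu]addn0 bran_bcat bran0.
Qed.

Lemma U_S_bfin mu p : U_S S (@BFin E mu p) <-> S (fran mu).
Proof. by split=> [[al [q [[<-]]]]//|Smu]; exists mu, p. Qed.

Lemma U_S_bcat mu x (h : fran mu = bsrc x) : U_S S (bcat h) <-> U_S S x.
Proof.
case: x h => [nu p|y] h; last by split=> -[al [q []]].
by have [k [q ->]] := bcat_fin h; rewrite !U_S_bfin fran_cat.
Qed.

Lemma U_HS_invariant : invariant (U_HS H S).
Proof.
by apply/invariantP => mu x h; split=> -[/U_H_bcat|/U_S_bcat]; by [left|right].
Qed.

Lemma U_HS_bfin mu p : U_HS H S (@BFin E mu p) <-> (H `|` S) (fran mu).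
Proof.
rewrite (invariant_bfin U_HS_invariant); split=> [[|/U_S_bfin]|[Hv|Sv]].
- by move=> [[|n] [w []]] /=; [move=> [<-]; left|rewrite onth0n].
- by right.
- by left; exists 0%N, (fran mu).
- by right; apply/U_S_bfin.
Qed.

Lemma U_HS_open : open (U_HS H S).
Proof.
apply/open_cylP => x [[n [v [/bran_split[mu [y [h [-> yv _]]]] Hv]]]|].
  exists mu, set0; split=> //; first exact/cylD_bcat.
  move=> _ [[z [k ->]] _]; left; exists (flen mu + 0)%N, v.
  by rewrite bran_bcat bran0 -k h yv.
move=> [al [p [-> Sal]]]; have [_ _ _ fin] := SB Sal.
(* These edges are finitely many because r(al) is a breaking vertex; once they are excluded, a path
   extending [al] is [al] itself or enters [H] at once. *)
exists al, (outedges (fran al) `&` @ran E @^-1` (~` H)); split=> //.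
  by have [h ->] := bfin_bcat p; apply/cylD_bcat.
move=> _ /[dup] -[[y [h ->]] _] /cylD_bcat nF.
rewrite invariantE; last exact: U_HS_invariant.
have [[e [z [k yE]]]|[w [q yE]]] := bpath_case y; subst y; last first.
  by right; apply/U_S_bfin; rewrite -[fran _]h.
rewrite invariantE; last exact: U_HS_invariant.
left; exists 0%N, (ran e); rewrite bran0 -k; split=> //.
apply: contrapT => nHe; apply: (nF e); last exact: trace_cat.
by split=> //; rewrite /outedges /= h bsrc_cat.
Qed.

(* If v is in H_U but not in H, an infinite path avoiding H (hence outside U)
   starts at v: a vertex outside H all of whose edges end in H is a sink or an
   infinite emitter by saturation, and it is not in B_H. *)
Lemma H_U_U_HS : H_U (U_HS H S) = H.
Proof.
apply/seteqP; split=> v; last first.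
  by move=> Hv; apply/H_UP => x xv; left; exists 0%N, v; rewrite bran0 xv.
move=> Uv; apply: contrapT => nHv.
(* Membership in [H_U] is carried along so that the argument can be repeated at each new vertex. *)
pose Q w := ~ H w /\ H_U (U_HS H S) w.
have step (w : {w | Q w}) : exists e, src e = sval w /\ Q (ran e).
  case: w => w /= [nHw Uw].
  have [e ew nHe] : exists2 e, src e = w & ~ H (ran e).
    apply: contrapT => ne.
    have he e : src e = w -> H (ran e).
      by move=> ew; apply: contrapT => nHe; apply: ne; exists e.
    have p : sink w \/ inf_emitter w.
      apply: contrapT => np; apply: nHw; apply: satH.
        by split=> ?; apply: np; [left|right].
      by move=> _ [e ew <-]; exact: he.
    have /H_UP/(_ (@BFin E (fvertex w) p) erefl)/U_HS_bfin[//|/SB] := Uw.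
    by move=> [_ _ [e [/he]]].
  exists e; split=> //; split=> //.
  by apply: (H_U_hereditary U_HS_invariant (mu := fedge e)); rewrite /= ew.
have [f hf] := choice step.
pose next (w : {w | Q w}) : {w | Q w} := exist Q (ran (f w)) (hf w).2.
pose t0 : {w | Q w} := exist Q v (conj nHv Uv).
have pathP i : ran (f (iter i next t0)) = src (f (iter i.+1 next t0)).
  by rewrite (hf _).1.
have /H_UP/(_ (BInf (IPath pathP))) := Uv.
rewrite /= /isrc /= (hf t0).1 => /(_ erefl)[[n [w [+ Hw]]]|[al [p []]]] //.
rewrite bran_inf /= (hf _).1 => -[wE].
by case: (svalP (iter n next t0)); rewrite wE.
Qed.

(** Once [H] is recovered, the trivial boundary path at a vertex outside [H] detects membership in
    [S]. *)
Lemma S_U_U_HS : S_U (U_HS H S) = S.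
Proof.
apply/seteqP; split=> v.
  by rewrite (S_UP U_HS_invariant) H_U_U_HS => -[_ nv [p /U_HS_bfin[]]].
move=> Sv; have [nv iv _ _] := SB Sv; have p : sink v \/ inf_emitter v by right.
rewrite (S_UP U_HS_invariant) H_U_U_HS; split=> //.
by exists p; apply/U_HS_bfin; right.
Qed.

End hereditary_saturated.

Lemma U_HS_mono (E : digraph) (H H' S S' : set (vertex E)) :
  hereditary H' -> H `<=` H' -> S `<=` S' `|` H' -> U_HS H S `<=` U_HS H' S'.
Proof.
move=> her HH SS x [[n [v [xv /HH Hv]]]|[al [p [-> /SS]]]].
  by left; exists n, v.
by move=> Sal; apply/U_HS_bfin => //; rewrite setUC.
Qed.

(** * Order isomorphisms as lattice morphisms *)

Lemma bij_mono_morphI d d' (T : latticeType d) (T' : latticeType d')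
    (f : T -> T') (g : T' -> T) : cancel g f -> {mono f : x y / (x <= y)%O} ->
  Order.meet_morphism f.
Proof.
move=> gK fle x y; apply/le_anti; rewrite lexI !fle leIl leIr /=.
(* The remaining inequality is pulled back along [g], where the universal property of the meet in
   [T] decides it. *)
by rewrite -[X in (X <= _)%O]gK fle lexI -!fle gK leIl leIr.
Qed.

Lemma bij_mono_morphU d d' (T : latticeType d) (T' : latticeType d')
    (f : T -> T') (g : T' -> T) : cancel g f -> {mono f : x y / (x <= y)%O} ->
  Order.join_morphism f.
Proof.
move=> gK fle x y; apply/le_anti; rewrite andbC leUx !fle leUl leUr /=.
by rewrite -[X in (_ <= X)%O]gK fle leUx -!fle gK leUl leUr.
Qed.

(** * The two mutually inverse maps *)

Section isomorphism.
Variable E : digraph.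

Definition TE_to_OE (p : TE E) : OE E :=
  MkOE (U_HS_open (@te_hereditary _ p) (@te_breaking _ p))
       (U_HS_invariant (S := teS p) (@te_hereditary _ p)).

Definition OE_to_TE (U : OE E) : TE E :=
  MkTE (H_U_hereditary (@oe_invariant _ U)) (H_U_saturated (@oe_invariant _ U))
       (S_U_breaking (@oe_invariant _ U) (@oe_open _ U)).

Lemma TE_to_OEK : cancel TE_to_OE OE_to_TE.
Proof.
case=> H S her sat SB; apply: TE_eq => /=; first exact: H_U_U_HS.
exact: S_U_U_HS.
Qed.

Lemma OE_to_TEK : cancel OE_to_TE TE_to_OE.
Proof.
move=> U; apply: OE_eq; apply: U_HS_H_U_S_U; first exact: oe_invariant.
exact: oe_open.
Qed.

Lemma le_TE_to_OE : {mono TE_to_OE : p q / (p <= q)%O}.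
Proof.
move=> p q; apply/asboolP/asboolP => [pq|[HH SS]]; last first.
  by apply: U_HS_mono => //; exact: te_hereditary.
(* The order is reflected because the inverse map is monotone. *)
rewrite -[p]TE_to_OEK -[q]TE_to_OEK.
by split; [exact: H_U_mono | exact: S_U_mono].
Qed.

HB.instance Definition _ := Order.isOrderMorphism.Build _ (TE E) _ (OE E)
  TE_to_OE (mono2W le_TE_to_OE).
HB.instance Definition _ := Order.isLatticeMorphism.Build _ (TE E) _ (OE E)
  TE_to_OE (bij_mono_morphI OE_to_TEK le_TE_to_OE)
  (bij_mono_morphU OE_to_TEK le_TE_to_OE).

End isomorphism.

Theorem theorem3p3 (E : digraph) :
  exists (phi : {lmorphism TE E -> OE E}) (rho : OE E -> TE E),
    [/\ forall p : TE E, oeU (phi p) = U_HS (teH p) (teS p),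
        forall U : OE E, teH (rho U) = H_U (oeU U) /\
                         teS (rho U) = S_U (oeU U),
        cancel phi rho & cancel rho phi].
Proof.
exists (@TE_to_OE E), (@OE_to_TE E); split=> //.
- exact: TE_to_OEK.
- exact: OE_to_TEK.
Qed.
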